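(* Let $f(s)=\sum_{n=1}^{\infty}a_n n^{-s}$ be a Dirichlet series with nonnegative coefficients $a_n\ge 0$, absolutely convergent for $\mathrm{Re}\,s>1$. Let $\sigma:\mathbb R_{>0}\to\mathbb R_{>0}$ be a continuous nondecreasing function and $\delta>0$ a constant such that $\sigma(x)>\delta$ for all $x$ and $\sigma(x)\le 1-\frac{2\log\log x}{\log x}$ for all sufficiently large $x$. Let $F$ be a positive increasing function growing at least as fast as $x$. Suppose that $f$ admits an analytic continuation to the region $\{s=\sigma+it:\ \sigma\ge\sigma(|t|),\ s\ne 1\}$, that in a neighbourhood of $s=1$ one has $f(s)\ll F\big(1/|s-1|\big)$, and that $|f(\sigma+it)|\ll |t|$ for all sufficiently large $|t|$ and all $\sigma\ge\sigma(|t|)$. Then $$\sup_{n\le x}a_n\ll x^{(\sigma(x)+1)/2}\sqrt{\log x}\,\sqrt{F_\infty(2x)},$$ where $F_\infty(x)=\inf_{\varepsilon>0}x^{\varepsilon}F(1/\varepsilon)$.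
   Context: $\ll$ denotes inequality up to a constant factor (Vinogradov notation), for $x$ sufficiently large.
   Formalization: ''F growing at least as fast as x'' is required as F(x) ≥ cx for all x > 0, not only large x: otherwise F may decay so fast at 0 that F_∞ = 0 and the claim fails for ζ; F such as x² are covered via max(F, cx), which leaves F_∞(x) unchanged for large x. *)

(* Defs.v *)
From Stdlib Require Export Reals.
From Coquelicot Require Export Coquelicot.
Local Open Scope R_scope.

(* Coquelicot has no complex exponential. *)
Definition Cexp (z : C) : C :=
  (exp (Re z) * cos (Im z), exp (Re z) * sin (Im z)).

(* Coquelicot series start at index 0: the term of index k is a_n n^{-s} with
   n = k + 1, so that a 0 plays no role. *)
Definition dirichlet_term (a : nat -> R) (s : C) (k : nat) : C :=
  (RtoC (a (S k)) * Cexp (- s * RtoC (ln (INR (S k)))))%C.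

Definition Cseries_to (u : nat -> C) (l : C) : Prop :=
  @is_series C_AbsRing C_NormedModule u l.

(* Analyticity at a point is complex differentiability in a neighbourhood of
   it; on a set that need not be open it is analyticity at every point. *)
Definition analytic_at (f : C -> C) (z : C) : Prop :=
  locally z (fun w : C => @ex_derive C_AbsRing C_NormedModule f w).

Definition analytic_on (f : C -> C) (D : C -> Prop) : Prop :=
  forall z : C, D z -> analytic_at f z.

(* The function t |-> sigma |t|.  As sigma is only given on the positive reals,
   the value at t = 0 is the limit sigma(0+), which exists for a nondecreasing
   sigma that is bounded below. *)
Definition left_boundary (sigma : R -> R) (t : R) : R :=
  if Req_EM_T t 0 then real (Lim (fun u => sigma (Rabs u)) 0)
  else sigma (Rabs t).

Definition region (sigma : R -> R) (s : C) : Prop :=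
  left_boundary sigma (Im s) <= Re s /\ s <> RtoC 1.

(* The infimum is finite as soon as F is positive on the positive reals. *)
Definition F_infty (F : R -> R) (x : R) : R :=
  real (Glb_Rbar (fun v => exists eps : R,
    0 < eps /\ v = Rpower x eps * F (1 / eps))).

(* The supremum is over a nonempty finite set as soon as 1 <= x. *)
Definition sup_upto (a : nat -> R) (x : R) : R :=
  real (Lub_Rbar (fun v => exists n : nat,
    (1 <= n)%nat /\ INR n <= x /\ v = a n)).

(* Main.v *)
(* With c = 1 + eps, the Fejer kernel gives
   int_0^T cos (theta t) (1 - t / T) dt = (1 - cos (theta T)) / (theta ^ 2 T) >= 0,
   and T / 2 when theta = 0.  As the coefficients are nonnegative, for every n
     a_n n ^ (- c) T / 2 <= Re (int_0^T f (c + i t) n ^ (i t) (1 - t / T) dt).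
   On [0, t1], with t1 fixed, |f| <= f c << F (1 / eps).  On [t1, T] the weight
   extends to the polynomial 1 + i (s - c) / T, and Cauchy's theorem moves the
   integral to Re s = sigma x for T <= x, where the bound f << |t| gives
   O (n ^ (sigma x - c) T ^ 2); the horizontal sides contribute O (1).  Hence
     a_n << x ^ (1 + eps) F (1 / eps) / T + x ^ (sigma x) T   (n <= x),
   and one takes eps nearly minimizing (2 x) ^ eps F (1 / eps) and
   T ^ 2 = x ^ (1 - sigma x) F_infty (2 x).  The hypothesis sigma > delta ensures T <= x. *)
Require Import Defs.
From Stdlib Require Import Reals.
From Coquelicot Require Import Coquelicot.
From Stdlib Require Import Classical_Prop Lra Lia.
Open Scope R_scope.

(** * Cauchy's theorem on rectangles *)

(** Each step moves to the first quarter on which [P] fails. The upper right quarter is the default: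
    when [P] passes from four quarters to the whole, it must fail there once the other three satisfy
    it. *)
Fixpoint bisect_corner (P : R -> R -> nat -> Prop)
    (dec : forall a c k, {P a c k} + {~ P a c k})
    (X Y xa ya : R) (k : nat) : R * R :=
  match k with
  | O => (xa, ya)
  | S j =>
      let (a, c) := bisect_corner P dec X Y xa ya j in
      let dx := X / 2 ^ S j in
      let dy := Y / 2 ^ S j in
      if dec a c (S j) then
        if dec (a + dx) c (S j) then
          if dec a (c + dy) (S j) then (a + dx, c + dy)
          else (a, c + dy)
        else (a + dx, c)
      else (a, c)
  end.

Lemma half_pow (X : R) (k : nat) : X / 2 ^ S k + X / 2 ^ S k = X / 2 ^ k.
Proof. simpl; field; apply pow_nonzero; lra. Qed.

(** The intervals [[u k, u k + X / 2 ^ k]] are nested and their lengths tend to 0. *)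
Lemma nested_point (u : nat -> R) (X : R) :
  (forall k, u k <= u (S k) <= u k + X / 2 ^ S k) -> 0 <= X ->
  exists p, forall k, u k <= p <= u k + X / 2 ^ k.
Proof.
intros Hu HX.
assert (Hinc : forall n, u n <= u (S n)) by (intro n; apply Hu).
assert (Hdec : forall n, u (S n) + X / 2 ^ S n <= u n + X / 2 ^ n).
{ intro n; generalize (half_pow X n) (Hu n); lra. }
destruct (ex_lim_seq_adj u (fun k => u k + X / 2 ^ k) Hinc Hdec)
  as [[p Hp] [[q Hq] Hpq]].
{ apply is_lim_seq_ext with (fun n => X * (/ 2) ^ n).
  - intro n; rewrite <- Rinv_pow_depr by lra; unfold Rdiv; ring.
  - replace (Finite 0) with (Rbar_mult X 0) by (simpl; f_equal; ring).
    apply is_lim_seq_scal_l, is_lim_seq_geom; rewrite Rabs_pos_eq; lra. }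
rewrite (is_lim_seq_unique _ _ Hp), (is_lim_seq_unique _ _ Hq) in Hpq.
injection Hpq as <-.
exists p; intro k; split.
- now apply is_lim_seq_incr_compare.
- exact (is_lim_seq_decr_compare _ _ Hq Hdec k).
Qed.

(* [P a c k] speaks of the rectangle with lower left corner [(a, c)] and sides
   [X / 2 ^ k] and [Y / 2 ^ k]. *)
Lemma rectangle_bisection (P : R -> R -> nat -> Prop) (X Y xa ya : R) :
  0 <= X -> 0 <= Y ->
  (forall a c k, {P a c k} + {~ P a c k}) ->
  (forall a c k, xa <= a -> a + X / 2 ^ k <= xa + X ->
     ya <= c -> c + Y / 2 ^ k <= ya + Y ->
     P a c (S k) -> P (a + X / 2 ^ S k) c (S k) ->
     P a (c + Y / 2 ^ S k) (S k) ->
     P (a + X / 2 ^ S k) (c + Y / 2 ^ S k) (S k) -> P a c k) ->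
  (forall x y, xa <= x <= xa + X -> ya <= y <= ya + Y ->
     exists d : posreal, forall a c k,
       xa <= a -> a + X / 2 ^ k <= xa + X ->
       ya <= c -> c + Y / 2 ^ k <= ya + Y ->
       a <= x <= a + X / 2 ^ k -> c <= y <= c + Y / 2 ^ k ->
       X / 2 ^ k < d -> Y / 2 ^ k < d -> P a c k) ->
  P xa ya O.
Proof.
intros HX HY dec Hsplit Hloc.
destruct (dec xa ya O) as [H0|H0]; [exact H0|exfalso].
set (z := bisect_corner P dec X Y xa ya).
assert (Hstep : forall k, z (S k) =
  let (a, c) := z k in
      let dx := X / 2 ^ S k in
      let dy := Y / 2 ^ S k in
      if dec a c (S k) then
        if dec (a + dx) c (S k) then
          if dec a (c + dy) (S k) then (a + dx, c + dy)
          else (a, c + dy)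
        else (a + dx, c)
      else (a, c)) by reflexivity.
assert (Hpos : forall Z k, 0 <= Z -> 0 <= Z / 2 ^ k).
{ intros Z k HZ; apply Rdiv_le_0_compat; [exact HZ|apply pow_lt; lra]. }
assert (Hz : forall k, (fst (z k) <= fst (z (S k)) <= fst (z k) + X / 2 ^ S k)
    /\ (snd (z k) <= snd (z (S k)) <= snd (z k) + Y / 2 ^ S k)).
{ intro k; rewrite Hstep; destruct (z k) as [a c]; cbv zeta.
  generalize (Hpos X (S k) HX) (Hpos Y (S k) HY); intros H1 H2.
  destruct (dec _ _ _); [|cbn [fst snd]; lra].
  destruct (dec _ _ _); [|cbn [fst snd]; lra].
  destruct (dec _ _ _); cbn [fst snd]; lra. }
assert (Hin : forall k, (xa <= fst (z k) /\ fst (z k) + X / 2 ^ k <= xa + X)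
    /\ (ya <= snd (z k) /\ snd (z k) + Y / 2 ^ k <= ya + Y)).
{ induction k as [|k IH].
  - simpl; lra.
  - pose proof (Hz k); pose proof (half_pow X k); pose proof (half_pow Y k); lra. }
assert (HP : forall k, ~ P (fst (z k)) (snd (z k)) k).
{ induction k as [|k IH]; [exact H0|].
  intro HPk; apply IH; generalize (Hin k) HPk; rewrite Hstep; clear IH HPk.
  destruct (z k) as [a c]; cbv zeta; cbn [fst snd]; intros Hi.
  destruct (dec a c (S k)) as [h1|h1]; [|tauto].
  destruct (dec _ c (S k)) as [h2|h2]; [|tauto].
  destruct (dec a _ (S k)) as [h3|h3]; [|tauto].
  cbn [fst snd]; intro h4; now apply Hsplit. }
destruct (nested_point (fun k => fst (z k)) X (fun k => proj1 (Hz k)) HX) as [p Hp].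
destruct (nested_point (fun k => snd (z k)) Y (fun k => proj2 (Hz k)) HY) as [q Hq].
destruct (Hloc p q) as [d Hd].
{ specialize (Hp O); simpl in Hp; lra. }
{ specialize (Hq O); simpl in Hq; lra. }
(* Here [(X + Y + 1) / 2 ^ N < d], so both sides of the [N]-th rectangle are shorter than [d] and
   locality contradicts [HP N]. *)
destruct (pow_lt_1_zero (/ 2)) with (y := d / (X + Y + 1)) as [N HN].
{ rewrite Rabs_pos_eq; lra. }
{ apply Rdiv_lt_0_compat; [apply cond_pos|lra]. }
specialize (HN N (le_n N)).
rewrite Rabs_pos_eq in HN by (apply pow_le; lra).
assert (H2 : 0 < (/ 2) ^ N) by (apply pow_lt; lra).
apply Rlt_div_r in HN; [|lra].
assert (Hd2 : forall Z, Z / 2 ^ N = Z * (/ 2) ^ N).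
{ intro Z; rewrite <- Rinv_pow_depr by lra; reflexivity. }
apply (HP N).
generalize (Hin N); intro HiN.
apply (Hd _ _ N); try tauto; try apply Hp; try apply Hq; rewrite Hd2; nra.
Qed.

(* The counterclockwise integral of [A dx + B dy] along the boundary. *)
Definition circulation (A B : R -> R -> R) (a b c d : R) : R :=
  RInt (fun x => A x c) a b + RInt (B b) c d
  - RInt (fun x => A x d) a b - RInt (B a) c d.

(** The affine function is integrated exactly, and the deviation costs at most [eta] times the
    length. *)
Lemma RInt_near_affine (g : R -> R) (al be eta a b : R) :
  a <= b -> ex_RInt g a b ->
  (forall x, a <= x <= b -> Rabs (g x - (al + be * x)) <= eta) ->
  Rabs (RInt g a b - (al * (b - a) + be * (b ^ 2 - a ^ 2) / 2)) <= eta * (b - a).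
Proof.
intros Hab Hg Hx.
assert (Haff : is_RInt (fun x => al + be * x) a b
   (al * (b - a) + be * (b ^ 2 - a ^ 2) / 2)).
{ replace (al * (b - a) + be * (b ^ 2 - a ^ 2) / 2)
    with (minus (al * b + be * b ^ 2 / 2) (al * a + be * a ^ 2 / 2))
    by (unfold minus, plus, opp; simpl; field).
  apply (is_RInt_derive (fun x => al * x + be * x ^ 2 / 2)).
  - intros x _; auto_derive; [trivial|field].
  - intros x _; apply (ex_derive_continuous (fun x => al + be * x)); now auto_derive. }
rewrite (Rmult_comm eta).
apply (norm_RInt_le_const (V := R_NormedModule)
         (fun x => minus (g x) (al + be * x)) a b); [exact Hab| |].
- exact Hx.
- apply @is_RInt_minus; [now apply @RInt_correct|exact Haff].
Qed.

Lemma continuity_2d_pt_section_x (g : R -> R -> R) (x y : R) :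
  continuity_2d_pt g x y -> continuous (fun u => g u y) x.
Proof.
intro Hg; apply filterlim_locally; intro eps.
destruct (Hg eps) as [d Hd]; exists d; intros u Hu; apply Hd; [exact Hu|].
rewrite Rminus_diag, Rabs_R0; apply cond_pos.
Qed.

Lemma continuity_2d_pt_section_y (g : R -> R -> R) (x y : R) :
  continuity_2d_pt g x y -> continuous (g x) y.
Proof.
intro Hg; apply filterlim_locally; intro eps.
destruct (Hg eps) as [d Hd]; exists d; intros u Hu; apply Hd; [|exact Hu].
rewrite Rminus_diag, Rabs_R0; apply cond_pos.
Qed.

(** The integrals along the new side [x = m] cancel, so only the horizontal sides, where [A] is
    integrated, have to be split. *)
Lemma circulation_halves_x (A B : R -> R -> R) (a m b c d : R) :
  a <= m <= b -> c <= d ->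
  (forall x y, a <= x <= b -> c <= y <= d -> continuity_2d_pt A x y) ->
  circulation A B a b c d = circulation A B a m c d + circulation A B m b c d.
Proof.
intros Hm Hcd HA; unfold circulation.
assert (Hex : forall y u v, c <= y <= d -> a <= u -> u <= v -> v <= b ->
   ex_RInt (fun x => A x y) u v).
{ intros y u v Hy Hu Huv Hv; apply @ex_RInt_continuous.
  rewrite Rmin_left, Rmax_right by lra.
  intros x Hx; apply continuity_2d_pt_section_x, HA; lra. }
rewrite <- (RInt_Chasles (fun x => A x c) a m b), <- (RInt_Chasles (fun x => A x d) a m b);
  try (apply Hex; lra).
unfold plus; simpl; lra.
Qed.

Lemma circulation_halves_y (A B : R -> R -> R) (a b c m d : R) :
  a <= b -> c <= m <= d ->
  (forall x y, a <= x <= b -> c <= y <= d -> continuity_2d_pt B x y) ->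
  circulation A B a b c d = circulation A B a b c m + circulation A B a b m d.
Proof.
intros Hab Hm HB; unfold circulation.
assert (Hex : forall x u v, a <= x <= b -> c <= u -> u <= v -> v <= d ->
   ex_RInt (B x) u v).
{ intros x u v Hx Hu Huv Hv; apply @ex_RInt_continuous.
  rewrite Rmin_left, Rmax_right by lra.
  intros y Hy; apply continuity_2d_pt_section_y, HB; lra. }
rewrite <- (RInt_Chasles (B a) c m d), <- (RInt_Chasles (B b) c m d);
  try (apply Hex; lra).
unfold plus; simpl; lra.
Qed.

(** The shared [l] is the closedness condition [dA/dy = dB/dx] for the form [A dx + B dy]. *)
Definition closed_form_at (A B : R -> R -> R) (x y : R) : Prop :=
  exists p l q, differentiable_pt_lim A x y p l /\ differentiable_pt_lim B x y l q.

(** The first order parts of [A] and [B] at [(x, y)] have zero circulation because their cross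
    derivatives agree. The remainder is at most [e / 2 * s] on a boundary of length [2 * s], where
    [s] is the half perimeter. *)
Lemma circulation_local (A B : R -> R -> R) (x y e : R) :
  closed_form_at A B x y -> 0 < e ->
  exists del : posreal, forall a b c d,
    a <= x <= b -> c <= y <= d -> b - a < del -> d - c < del ->
    (forall u v, a <= u <= b -> c <= v <= d ->
       continuity_2d_pt A u v /\ continuity_2d_pt B u v) ->
    Rabs (circulation A B a b c d) <= e * ((b - a) + (d - c)) ^ 2.
Proof.
intros (p & l & q & HA & HB) He.
assert (He2 : 0 < e / 2) by lra.
destruct (HA (mkposreal _ He2)) as [d1 H1].
destruct (HB (mkposreal _ He2)) as [d2 H2].
exists (mkposreal _ (Rmin_stable_in_posreal d1 d2)).
intros a b c d Hx Hy Hab Hcd Hc; cbn [pos] in *.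
generalize (Rmin_l d1 d2) (Rmin_r d1 d2); intros Hd1 Hd2.
set (s := (b - a) + (d - c)).
assert (Hmax : forall u v, a <= u <= b -> c <= v <= d ->
   Rmax (Rabs (u - x)) (Rabs (v - y)) <= s).
{ intros u v Hu Hv; apply Rmax_lub; apply Rabs_le; unfold s; lra. }
assert (near : forall u v, a <= u <= b -> c <= v <= d ->
   Rabs (A u v - A x y - (p * (u - x) + l * (v - y))) <= e / 2 * s /\
   Rabs (B u v - B x y - (l * (u - x) + q * (v - y))) <= e / 2 * s).
{ intros u v Hu Hv.
  assert (Hux : Rabs (u - x) < Rmin d1 d2) by (apply Rabs_def1; lra).
  assert (Hvy : Rabs (v - y) < Rmin d1 d2) by (apply Rabs_def1; lra).
  specialize (Hmax u v Hu Hv).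
  split; (eapply Rle_trans;
    [apply H1 || apply H2; lra|apply Rmult_le_compat_l; lra]). }
assert (HAx : forall v, c <= v <= d ->
  Rabs (RInt (fun u => A u v) a b - ((A x y - p * x + l * (v - y)) * (b - a)
     + p * (b ^ 2 - a ^ 2) / 2)) <= e / 2 * s * (b - a)).
{ intros v Hv; apply RInt_near_affine; [lra| |].
  - apply @ex_RInt_continuous; rewrite Rmin_left, Rmax_right by lra.
    intros u Hu; apply continuity_2d_pt_section_x, Hc; lra.
  - intros u Hu; replace (A u v - _)
      with (A u v - A x y - (p * (u - x) + l * (v - y))) by ring.
    now apply near. }
assert (HBy : forall u, a <= u <= b ->
  Rabs (RInt (B u) c d - ((B x y - q * y + l * (u - x)) * (d - c)
     + q * (d ^ 2 - c ^ 2) / 2)) <= e / 2 * s * (d - c)).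
{ intros u Hu; apply RInt_near_affine; [lra| |].
  - apply @ex_RInt_continuous; rewrite Rmin_left, Rmax_right by lra.
    intros v Hv; apply continuity_2d_pt_section_y, Hc; lra.
  - intros v Hv; replace (B u v - _)
      with (B u v - B x y - (l * (u - x) + q * (v - y))) by ring.
    now apply near. }
generalize (HAx c ltac:(lra)) (HAx d ltac:(lra)) (HBy a ltac:(lra)) (HBy b ltac:(lra)).
unfold circulation; intros K1 K2 K3 K4.
apply Rabs_le_between in K1; apply Rabs_le_between in K2.
apply Rabs_le_between in K3; apply Rabs_le_between in K4.
replace (e * s ^ 2) with (2 * (e / 2 * s * (b - a)) + 2 * (e / 2 * s * (d - c)))
  by (unfold s; field).
apply Rabs_le; split; lra.
Qed.

(** Goursat's argument: the bound [kap / 4 ^ k] passes from four quarters to the whole and holds on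
    small rectangles, so by bisection the circulation is at most [kap], for every [kap > 0]. *)
Lemma goursat_rectangle (A B : R -> R -> R) (a b c d : R) :
  a < b -> c < d ->
  (forall x y, a <= x <= b -> c <= y <= d -> closed_form_at A B x y) ->
  circulation A B a b c d = 0.
Proof.
intros Hab Hcd Hcl.
assert (Hcont : forall x y, a <= x <= b -> c <= y <= d ->
  continuity_2d_pt A x y /\ continuity_2d_pt B x y).
{ intros x y Hx Hy; destruct (Hcl x y Hx Hy) as (p & l & q & H1 & H2).
  split; apply differentiable_continuity_pt; [exists p, l|exists l, q]; assumption. }
set (X := b - a); set (Y := d - c).
assert (HX : 0 < X) by (unfold X; lra).
assert (HY : 0 < Y) by (unfold Y; lra).
assert (key : forall kap, 0 < kap -> Rabs (circulation A B a b c d) <= kap).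
{ intros kap Hkap.
  set (P := fun u v k =>
     Rabs (circulation A B u (u + X / 2 ^ k) v (v + Y / 2 ^ k)) <= kap / 4 ^ k).
  assert (HP : P a c O).
  { apply (rectangle_bisection P X Y a c); try lra.
    - intros u v k; unfold P; apply Rle_dec.
    - intros u v k Hu Hu' Hv Hv' P1 P2 P3 P4; unfold P in *.
      assert (Hx2 := half_pow X k); assert (Hy2 := half_pow Y k).
      set (hx := X / 2 ^ S k) in *; set (hy := Y / 2 ^ S k) in *.
      assert (0 < hx) by (apply Rdiv_lt_0_compat; [lra|apply pow_lt; lra]).
      assert (0 < hy) by (apply Rdiv_lt_0_compat; [lra|apply pow_lt; lra]).
      rewrite <- Hx2, <- Hy2 in *.
      unfold X, Y in Hu', Hv'.
      rewrite (circulation_halves_x A B u (u + hx)); [|lra|lra|intros; apply Hcont; lra].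
      rewrite (circulation_halves_y A B u (u + hx) v (v + hy));
        [|lra|lra|intros; apply Hcont; lra].
      rewrite (circulation_halves_y A B (u + hx) (u + (hx + hx)) v (v + hy));
        [|lra|lra|intros; apply Hcont; lra].
      rewrite <- !Rplus_assoc.
      replace (kap / 4 ^ k) with (4 * (kap / 4 ^ S k))
        by (simpl; field; apply pow_nonzero; lra).
      rewrite !Rplus_assoc in *.
      apply Rabs_le_between in P1; apply Rabs_le_between in P2.
      apply Rabs_le_between in P3; apply Rabs_le_between in P4.
      apply Rabs_le; lra.
    - intros x y Hx Hy; unfold X, Y in Hx, Hy.
      (* With this constant the local bound for sides [X / 2 ^ k] and [Y / 2 ^ k] is exactly
         [kap / 4 ^ k]. *)
      assert (He : 0 < kap / (X + Y) ^ 2)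
        by (apply Rdiv_lt_0_compat; [lra|apply pow_lt; lra]).
      destruct (circulation_local A B x y _ (Hcl x y ltac:(lra) ltac:(lra)) He)
        as [del Hdel].
      exists del; intros u v k Hu Hu' Hv Hv' Hxu Hyv Hk1 Hk2; unfold P.
      unfold X, Y in Hu', Hv'.
      eapply Rle_trans;
        [apply Hdel; try lra; intros; apply Hcont; unfold X, Y in *; lra|].
      apply Req_le; replace (4 ^ k) with (2 ^ k * 2 ^ k)
        by (rewrite <- Rpow_mult_distr; f_equal; ring).
      field; split; [apply pow_nonzero; lra|lra]. }
  unfold P in HP; simpl in HP; rewrite !Rdiv_1_r in HP.
  unfold X, Y in HP.
  replace (a + (b - a)) with b in HP by ring.
  now replace (c + (d - c)) with d in HP by ring. }
apply Rabs_eq_0.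
apply Rle_antisym; [|apply Rabs_pos].
apply le_epsilon; intros eps Heps; rewrite Rplus_0_l; now apply key.
Qed.

(** * Complex differentiability in real terms *)

(* The Cauchy-Riemann equations for real differentiable components, with
   derivative [p + i q]. *)
Definition holomorphic_at (g : C -> C) (z : C) : Prop :=
  exists p q,
    differentiable_pt_lim (fun u v => Re (g (u, v))) (Re z) (Im z) p (- q) /\
    differentiable_pt_lim (fun u v => Im (g (u, v))) (Re z) (Im z) q p.

Lemma locally_2d_of_C (z : C) (P : C -> Prop) :
  @locally (AbsRing_UniformSpace C_AbsRing) z P ->
  locally_2d (fun u v => P (u, v)) (Re z) (Im z).
Proof.
intros [d Hd].
(* The modulus is at most [sqrt 2 < 2] times the larger coordinate, so a square of half side [d / 2]
   fits in the disc. *)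
assert (Hd2 : 0 < d / 2) by (generalize (cond_pos d); lra).
exists (mkposreal _ Hd2); intros u v Hu Hv; simpl in Hu, Hv.
apply Hd; unfold ball; simpl; unfold AbsRing_ball.
change (Cmod ((u, v) - z)%C < d).
eapply Rle_lt_trans; [apply Cmod_2Rmax|].
change (sqrt 2 * Rmax (Rabs (u - Re z)) (Rabs (v - Im z)) < d).
assert (Hm : Rmax (Rabs (u - Re z)) (Rabs (v - Im z)) < d / 2)
  by (now apply Rmax_lub_lt).
assert (sqrt 2 < 2).
{ rewrite <- (sqrt_square 2) at 2 by lra; apply sqrt_lt_1; lra. }
assert (0 <= Rmax (Rabs (u - Re z)) (Rabs (v - Im z)))
  by (eapply Rle_trans; [apply Rabs_pos|apply Rmax_l]).
generalize (sqrt_pos 2); nra.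
Qed.

(** Multiplication by the derivative [p + i q] is the real linear map
    [(u, v) -> (p u - q v, q u + p v)]. Comparing the modulus with the maximum norm costs
    [sqrt 2 <= 2], whence the use of [eps / 2]. *)
Lemma ex_derive_holomorphic (f : C -> C) (z : C) :
  @ex_derive C_AbsRing C_NormedModule f z -> holomorphic_at f z.
Proof.
intros [[p q] [_ Hl]].
specialize (Hl z (fun P H => H)).
exists p, q.
assert (key : forall eps : posreal, locally_2d (fun u v =>
   Rmax (Rabs (Re (f (u, v)) - Re (f z) - (p * (u - Re z) + - q * (v - Im z))))
        (Rabs (Im (f (u, v)) - Im (f z) - (q * (u - Re z) + p * (v - Im z))))
     <= eps * Rmax (Rabs (u - Re z)) (Rabs (v - Im z))) (Re z) (Im z)).
{ intro eps.
  assert (He : 0 < eps / 2) by (generalize (cond_pos eps); lra).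
  specialize (Hl (mkposreal _ He)); apply locally_2d_of_C in Hl.
  revert Hl; apply locally_2d_impl, locally_2d_forall; intros u v H.
  change (Cmod (f (u, v) - f z - ((u, v) - z) * (p, q))%C
          <= eps / 2 * Cmod ((u, v) - z)%C) in H.
  eapply Rle_trans; [|eapply Rle_trans; [apply H|]].
  - eapply Rle_trans; [|apply Rmax_Cmod].
    apply Req_le; f_equal; f_equal; destruct z as [z1 z2];
      unfold Re, Im, Cminus, Cplus, Copp, Cmult; simpl; ring.
  - assert (Hs : sqrt 2 <= 2).
    { rewrite <- (sqrt_square 2) at 2 by lra; apply sqrt_le_1; lra. }
    generalize (Cmod_2Rmax ((u, v) - z)%C); intro Hm.
    change (Cmod ((u, v) - z)%C <= sqrt 2 * Rmax (Rabs (u - Re z)) (Rabs (v - Im z))) in Hm.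
    assert (0 <= Rmax (Rabs (u - Re z)) (Rabs (v - Im z)))
      by (eapply Rle_trans; [apply Rabs_pos|apply Rmax_l]).
    apply Rle_trans with (eps / 2 * (2 * Rmax (Rabs (u - Re z)) (Rabs (v - Im z)))).
    + apply Rmult_le_compat_l; [lra|].
      eapply Rle_trans; [exact Hm|now apply Rmult_le_compat_r].
    + apply Req_le; field. }
destruct z as [z1 z2].
split; intro eps; generalize (key eps); apply locally_2d_impl, locally_2d_forall;
  intros u v H; (eapply Rle_trans; [|exact H]); [apply Rmax_l|apply Rmax_r].
Qed.

Lemma differentiable_pt_lim_Rmult (x y : R) : differentiable_pt_lim Rmult x y y x.
Proof.
intro eps; exists eps; intros u v Hu Hv.
replace (u * v - x * y - (y * (u - x) + x * (v - y)))
  with ((u - x) * (v - y)) by ring.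
rewrite Rabs_mult; apply Rmult_le_compat; try apply Rabs_pos; [lra|apply Rmax_r].
Qed.

Lemma differentiable_pt_lim_Rplus (x y : R) : differentiable_pt_lim Rplus x y 1 1.
Proof.
intro eps; exists eps; intros u v Hu Hv.
replace (u + v - (x + y) - (1 * (u - x) + 1 * (v - y))) with 0 by ring.
rewrite Rabs_R0; apply Rmult_le_pos; [apply Rlt_le, cond_pos|].
eapply Rle_trans; [apply Rabs_pos|apply Rmax_l].
Qed.

Lemma differentiable_pt_lim_snd (h : R -> R) (x y l : R) :
  is_derive h y l -> differentiable_pt_lim (fun _ v => h v) x y 0 l.
Proof.
intro H; apply is_derive_Reals, differentiable_pt_lim_proj1_0 with (y := x) in H.
intro eps; destruct (H eps) as [d Hd]; exists d; intros u v Hu Hv.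
generalize (Hd v u Hv Hu); rewrite Rmax_comm.
replace (l * (v - y) + 0 * (u - x)) with (0 * (u - x) + l * (v - y)) by ring; trivial.
Qed.

Lemma differentiable_pt_lim_fst (h : R -> R) (x y l : R) :
  is_derive h x l -> differentiable_pt_lim (fun u _ => h u) x y l 0.
Proof. intro H; now apply differentiable_pt_lim_proj1_0, is_derive_Reals. Qed.

Lemma differentiable_pt_lim_mult (f g : R -> R -> R) (x y fx fy gx gy : R) :
  differentiable_pt_lim f x y fx fy -> differentiable_pt_lim g x y gx gy ->
  differentiable_pt_lim (fun u v => f u v * g u v) x y
    (fx * g x y + f x y * gx) (fy * g x y + f x y * gy).
Proof.
intros Hf Hg.
generalize (differentiable_pt_lim_comp Rmult f g x y _ _ _ _ _ _
  (differentiable_pt_lim_Rmult _ _) Hf Hg).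
now rewrite !(Rmult_comm (g x y)).
Qed.

Lemma differentiable_pt_lim_plus (f g : R -> R -> R) (x y fx fy gx gy : R) :
  differentiable_pt_lim f x y fx fy -> differentiable_pt_lim g x y gx gy ->
  differentiable_pt_lim (fun u v => f u v + g u v) x y (fx + gx) (fy + gy).
Proof.
intros Hf Hg.
generalize (differentiable_pt_lim_comp Rplus f g x y _ _ _ _ _ _
  (differentiable_pt_lim_Rplus _ _) Hf Hg).
now rewrite !Rmult_1_l.
Qed.

Lemma differentiable_pt_lim_opp (f : R -> R -> R) (x y fx fy : R) :
  differentiable_pt_lim f x y fx fy ->
  differentiable_pt_lim (fun u v => - f u v) x y (- fx) (- fy).
Proof.
intros Hf eps; generalize (Hf eps); apply locally_2d_impl, locally_2d_forall.
intros u v H; rewrite <- Rabs_Ropp.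
now replace (- _) with (f u v - f x y - (fx * (u - x) + fy * (v - y))) by ring.
Qed.

Lemma differentiable_pt_lim_eq (f : R -> R -> R) (x y fx fy gx gy : R) :
  differentiable_pt_lim f x y fx fy -> fx = gx -> fy = gy ->
  differentiable_pt_lim f x y gx gy.
Proof. now intros H <- <-. Qed.

Lemma holomorphic_mult (f g : C -> C) (z : C) :
  holomorphic_at f z -> holomorphic_at g z -> holomorphic_at (fun s => f s * g s)%C z.
Proof.
destruct z as [x y]; intros (p & q & H1 & H2) (p' & q' & H3 & H4).
change (Re (x, y)) with x in *; change (Im (x, y)) with y in *.
set (f1 := Re (f (x, y))); set (f2 := Im (f (x, y))).
set (g1 := Re (g (x, y))); set (g2 := Im (g (x, y))).
exists (p * g1 + f1 * p' - (q * g2 + f2 * q')), (p * g2 + f1 * q' + (q * g1 + f2 * p')).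
split.
- eapply differentiable_pt_lim_eq.
  + exact (differentiable_pt_lim_plus _ _ _ _ _ _ _ _
      (differentiable_pt_lim_mult _ _ _ _ _ _ _ _ H1 H3)
      (differentiable_pt_lim_opp _ _ _ _ _
        (differentiable_pt_lim_mult _ _ _ _ _ _ _ _ H2 H4))).
  + unfold f1, f2, g1, g2; ring.
  + unfold f1, f2, g1, g2; ring.
- eapply differentiable_pt_lim_eq.
  + exact (differentiable_pt_lim_plus _ _ _ _ _ _ _ _
      (differentiable_pt_lim_mult _ _ _ _ _ _ _ _ H1 H4)
      (differentiable_pt_lim_mult _ _ _ _ _ _ _ _ H2 H3)).
  + unfold f1, f2, g1, g2; ring.
  + unfold f1, f2, g1, g2; ring.
Qed.

Lemma holomorphic_exp (lam c : R) (z : C) :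
  holomorphic_at (fun s => Cexp ((s - RtoC c) * RtoC lam)%C) z.
Proof.
destruct z as [x y].
assert (He : forall t, is_derive (fun u => exp ((u - c) * lam)) t (lam * exp ((t - c) * lam))).
{ intro t; auto_derive; [trivial|unfold Rminus; ring]. }
assert (Hc : forall t, is_derive (fun v => cos (v * lam)) t (- lam * sin (t * lam))).
{ intro t; auto_derive; [trivial|ring]. }
assert (Hs : forall t, is_derive (fun v => sin (v * lam)) t (lam * cos (t * lam))).
{ intro t; auto_derive; [trivial|ring]. }
exists (lam * exp ((x - c) * lam) * cos (y * lam)),
       (lam * exp ((x - c) * lam) * sin (y * lam)).
split.
- generalize (differentiable_pt_lim_mult _ _ _ _ _ _ _ _
    (differentiable_pt_lim_fst _ x y _ (He x)) (differentiable_pt_lim_snd _ x y _ (Hc y))).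
  change (Re (x, y)) with x; change (Im (x, y)) with y.
  replace (lam * exp ((x - c) * lam) * cos (y * lam) + exp ((x - c) * lam) * 0)
    with (lam * exp ((x - c) * lam) * cos (y * lam)) by ring.
  replace (0 * cos (y * lam) + exp ((x - c) * lam) * (- lam * sin (y * lam)))
    with (- (lam * exp ((x - c) * lam) * sin (y * lam))) by ring.
  apply differentiable_pt_lim_ext, locally_2d_forall; intros u v.
  unfold Cexp, Re, Im; simpl; f_equal; f_equal; ring.
- generalize (differentiable_pt_lim_mult _ _ _ _ _ _ _ _
    (differentiable_pt_lim_fst _ x y _ (He x)) (differentiable_pt_lim_snd _ x y _ (Hs y))).
  change (Re (x, y)) with x; change (Im (x, y)) with y.
  replace (lam * exp ((x - c) * lam) * sin (y * lam) + exp ((x - c) * lam) * 0)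
    with (lam * exp ((x - c) * lam) * sin (y * lam)) by ring.
  replace (0 * sin (y * lam) + exp ((x - c) * lam) * (lam * cos (y * lam)))
    with (lam * exp ((x - c) * lam) * cos (y * lam)) by ring.
  apply differentiable_pt_lim_ext, locally_2d_forall; intros u v.
  unfold Cexp, Re, Im; simpl; f_equal; f_equal; ring.
Qed.

(* The holomorphic function equal to the Fejer weight [1 - t / T] on the line [Re s = c]. *)
Definition fejer_weight (c T : R) (s : C) : C := (1 - Im s / T, (Re s - c) / T).

Lemma holomorphic_fejer_weight (c T : R) (z : C) : holomorphic_at (fejer_weight c T) z.
Proof.
exists 0, (/ T); split.
- apply (differentiable_pt_lim_snd (fun v => 1 - v / T)).
  auto_derive; [trivial|unfold Rdiv; ring].
- apply (differentiable_pt_lim_fst (fun u => (u - c) / T)).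
  auto_derive; [trivial|unfold Rdiv; ring].
Qed.

(** The form is [Im (g dz) = Im g dx + Re g dy], closed by the Cauchy-Riemann equations. On vertical
    sides it integrates [Re g], as the Fejer argument requires. *)
Lemma holomorphic_closed_form (g : C -> C) (z : C) :
  holomorphic_at g z ->
  closed_form_at (fun u v => Im (g (u, v))) (fun u v => Re (g (u, v))) (Re z) (Im z).
Proof. intros (p & q & H1 & H2); now exists q, p, (- q). Qed.

(** * The Fejer kernel and the contour shift *)

Lemma Cmod_Cexp (z : C) : Cmod (Cexp z) = exp (Re z).
Proof.
unfold Cmod, Cexp; cbn [fst snd].
replace (_ + _) with (exp (Re z) ^ 2 * ((sin (Im z))² + (cos (Im z))²))
  by (unfold Rsqr; ring).
rewrite sin2_cos2, Rmult_1_r; apply sqrt_pow2, Rlt_le, exp_pos.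
Qed.

Lemma Cmod_le_Rabs (u v : R) : Cmod (u, v) <= Rabs u + Rabs v.
Proof.
generalize (Cmod_triangle (u, 0) (0, v)).
replace ((u, 0) + (0, v))%C with ((u, v) : C) by (unfold Cplus; simpl; f_equal; ring).
replace (Cmod (u, 0)) with (Rabs u) by (symmetry; apply Cmod_R).
replace (Cmod (0, v)) with (Rabs v); [trivial|].
unfold Cmod; cbn [fst snd]; replace (0 ^ 2 + v ^ 2) with (v²) by (unfold Rsqr; ring).
symmetry; apply sqrt_Rsqr_abs.
Qed.

Lemma exp_le_compat (u v : R) : u <= v -> exp u <= exp v.
Proof. intros [H| ->]; [now apply Rlt_le, exp_increasing|apply Rle_refl]. Qed.

(** For [lam = ln n] this is [f(s) n^(s - c)]: on [Re s = c] the factor is the phase [n^(i t)], and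
    to the left it is damped by [n^(Re s - c)]. *)
Definition twist (f : C -> C) (c lam : R) (s : C) : C :=
  (f s * Cexp ((s - RtoC c) * RtoC lam))%C.

(* On the top side [Im s = T] the Fejer weight has modulus [|Re s - c| / T], which
   absorbs the growth [M T] of [f] there. *)
Lemma contour_shift (f : C -> C) (sg c t1 T lam M : R) :
  sg < c -> c - sg <= 2 -> 0 < t1 -> t1 < T -> 1 <= T -> 0 <= lam -> 0 <= M ->
  (forall u t, sg <= u <= c -> t1 <= t <= T ->
     @ex_derive C_AbsRing C_NormedModule f (u, t)) ->
  (forall u t, sg <= u <= c -> t1 <= t <= T -> Cmod (f (u, t)) <= M * t) ->
  ex_RInt (fun t => Re (twist f c lam (c, t)) * (1 - t / T)) t1 T /\
  RInt (fun t => Re (twist f c lam (c, t)) * (1 - t / T)) t1 T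
    <= 3 * M * exp ((sg - c) * lam) * T ^ 2 + 6 * M * t1 + 4 * M.
Proof.
intros Hsg Hc2 Ht1 HT HT1 Hlam HM Hder Hbd.
set (G := fun s => (twist f c lam s * fejer_weight c T s)%C).
assert (Hhol : forall u t, sg <= u <= c -> t1 <= t <= T -> holomorphic_at G (u, t)).
{ intros u t Hu Ht; unfold G, twist.
  apply (holomorphic_mult (fun s => (f s * Cexp ((s - RtoC c) * RtoC lam))%C));
    [apply (holomorphic_mult f)|].
  - now apply ex_derive_holomorphic, Hder.
  - apply holomorphic_exp.
  - apply holomorphic_fejer_weight. }
assert (Hcont : forall u t, sg <= u <= c -> t1 <= t <= T ->
   continuity_2d_pt (fun u v => Re (G (u, v))) u t /\
   continuity_2d_pt (fun u v => Im (G (u, v))) u t).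
{ intros u t Hu Ht; destruct (Hhol u t Hu Ht) as (p & q & H1 & H2).
  split; apply differentiable_continuity_pt; [exists p, (- q)|exists q, p]; assumption. }
assert (Hint : forall u, sg <= u <= c -> ex_RInt (fun t => Re (G (u, t))) t1 T).
{ intros u Hu; apply @ex_RInt_continuous; rewrite Rmin_left, Rmax_right by lra.
  intros t Ht; now apply (continuity_2d_pt_section_y (fun u v => Re (G (u, v)))), Hcont. }
assert (Hint' : forall t, t1 <= t <= T -> ex_RInt (fun u => Im (G (u, t))) sg c).
{ intros t Ht; apply @ex_RInt_continuous; rewrite Rmin_left, Rmax_right by lra.
  intros u Hu; now apply (continuity_2d_pt_section_x (fun u v => Im (G (u, v)))), Hcont. }
assert (Hedge : forall t, Re (G (c, t)) = Re (twist f c lam (c, t)) * (1 - t / T)).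
{ intro t; unfold G; set (w := twist f c lam (c, t)).
  unfold fejer_weight, Re, Im; simpl; unfold Rdiv; ring. }
assert (Hext : ex_RInt (fun t => Re (twist f c lam (c, t)) * (1 - t / T)) t1 T).
{ apply ex_RInt_ext with (fun t => Re (G (c, t))); [intros; apply Hedge|].
  apply Hint; lra. }
split; [exact Hext|].
rewrite <- (RInt_ext (fun t => Re (G (c, t)))) by (intros; apply Hedge).
(* By Cauchy's theorem the integral over the right side equals that over the left side plus the top
   minus the bottom. *)
assert (Hcirc : circulation (fun u v => Im (G (u, v))) (fun u v => Re (G (u, v)))
   sg c t1 T = 0).
{ apply goursat_rectangle; [lra|lra|intros u t Hu Ht].
  now apply (holomorphic_closed_form G (u, t)), Hhol. }
unfold circulation in Hcirc.
assert (HG : forall u t, Cmod (G (u, t)) <=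
   Cmod (f (u, t)) * exp ((u - c) * lam) * (Rabs (1 - t / T) + Rabs ((u - c) / T))).
{ intros u t; unfold G, twist; rewrite !Cmod_mult, Cmod_Cexp.
  replace (Re (((u, t) - RtoC c) * RtoC lam)) with ((u - c) * lam)
    by (unfold Re; simpl; ring).
  apply Rmult_le_compat_l; [|apply Cmod_le_Rabs].
  apply Rmult_le_pos; [apply Cmod_ge_0|apply Rlt_le, exp_pos]. }
assert (Hre : forall z : C, Rabs (Re z) <= Cmod z) by apply re_le_Cmod.
assert (Him : forall z : C, Rabs (Im z) <= Cmod z).
{ intro z; eapply Rle_trans; [apply Rmax_r|apply Rmax_Cmod]. }
assert (HTi : 0 < / T) by (apply Rinv_0_lt_compat; lra).
assert (HTT : T * / T = 1) by (apply Rinv_r; lra).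
assert (Hw : forall u t, sg <= u <= c -> t1 <= t <= T ->
  Rabs (1 - t / T) + Rabs ((u - c) / T) = 1 - t / T + (c - u) / T).
{ intros u t Hu Ht; rewrite Rabs_pos_eq, (Rabs_left1 ((u - c) / T)).
  - unfold Rdiv; ring.
  - unfold Rdiv; nra.
  - unfold Rdiv; nra. }
(* Here [1 - t / T <= 1], and [(c - u) / T <= 2] because [c - sg <= 2] and [T >= 1]. *)
assert (Hw3 : forall u t, sg <= u <= c -> t1 <= t <= T -> 0 <= 1 - t / T + (c - u) / T <= 3).
{ intros u t Hu Ht; unfold Rdiv; nra. }
assert (Hexp1 : forall u, u <= c -> exp ((u - c) * lam) <= 1).
{ intros u Hu; rewrite <- exp_0; apply exp_le_compat; nra. }
(* The main term, of order [T ^ 2]. Only on this side is the damping factor kept; on the horizontal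
   sides it is bounded by 1. *)
assert (Hleft : Rabs (RInt (fun t => Re (G (sg, t))) t1 T)
   <= (T - t1) * (M * T * exp ((sg - c) * lam) * 3)).
{ apply abs_RInt_le_const; [lra|apply Hint; lra|intros t Ht].
  eapply Rle_trans; [apply Hre|eapply Rle_trans; [apply HG|]].
  rewrite Hw by lra; generalize (Hw3 sg t ltac:(lra) Ht); intros [h1 h2].
  apply Rmult_le_compat; [|exact h1| |exact h2].
  - apply Rmult_le_pos; [apply Cmod_ge_0|apply Rlt_le, exp_pos].
  - apply Rmult_le_compat_r; [apply Rlt_le, exp_pos|].
    eapply Rle_trans; [apply Hbd; lra|apply Rmult_le_compat_l; lra]. }
assert (Hbot : Rabs (RInt (fun u => Im (G (u, t1))) sg c) <= (c - sg) * (M * t1 * 1 * 3)).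
{ apply abs_RInt_le_const; [lra|apply Hint'; lra|intros u Hu].
  eapply Rle_trans; [apply Him|eapply Rle_trans; [apply HG|]].
  rewrite Hw by lra; generalize (Hw3 u t1 Hu ltac:(lra)); intros [h1 h2].
  apply Rmult_le_compat; [|exact h1| |exact h2].
  - apply Rmult_le_pos; [apply Cmod_ge_0|apply Rlt_le, exp_pos].
  - apply Rmult_le_compat; [apply Cmod_ge_0|apply Rlt_le, exp_pos| |apply Hexp1; lra].
    apply Hbd; lra. }
assert (Htop : Rabs (RInt (fun u => Im (G (u, T))) sg c) <= (c - sg) * (M * T * 1 * (2 / T))).
{ apply abs_RInt_le_const; [lra|apply Hint'; lra|intros u Hu].
  eapply Rle_trans; [apply Him|eapply Rle_trans; [apply HG|]].
  rewrite Hw by lra.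
  apply Rmult_le_compat.
  - apply Rmult_le_pos; [apply Cmod_ge_0|apply Rlt_le, exp_pos].
  - apply Hw3; lra.
  - apply Rmult_le_compat; [apply Cmod_ge_0|apply Rlt_le, exp_pos| |apply Hexp1; lra].
    apply Hbd; lra.
  - unfold Rdiv; nra. }
replace (M * T * 1 * (2 / T)) with (2 * M) in Htop by (field; lra).
apply Rabs_le_between in Hleft; apply Rabs_le_between in Hbot.
apply Rabs_le_between in Htop.
generalize (exp_pos ((sg - c) * lam)); intro He.
set (e := exp ((sg - c) * lam)) in *.
assert (0 <= M * e) by nra.
assert ((T - t1) * (M * T * e * 3) <= 3 * M * e * T ^ 2) by nra.
assert ((c - sg) * (M * t1 * 1 * 3) <= 6 * M * t1) by (assert (0 <= M * t1) by nra; nra).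
assert ((c - sg) * (2 * M) <= 4 * M) by nra.
lra.
Qed.

(** This lets all terms but one be discarded: every frequency contributes a nonnegative amount, and
    frequency 0 contributes [T / 2]. *)
Lemma is_RInt_fejer_cos (th T : R) : 0 < T ->
  exists I, is_RInt (fun t => cos (t * th) * (1 - t / T)) 0 T I /\
    0 <= I /\ (th = 0 -> I = T / 2).
Proof.
intro HT; destruct (Req_dec th 0) as [->|Hth].
- exists (T / 2); repeat split; [|lra].
  replace (T / 2) with (minus (T - T ^ 2 / (2 * T)) (0 - 0 ^ 2 / (2 * T)))
    by (unfold minus, plus, opp; simpl; field; lra).
  apply (is_RInt_derive (fun t => t - t ^ 2 / (2 * T))).
  + intros t _; auto_derive; [trivial|rewrite Rmult_0_r, cos_0; field; lra].
  + intros t _; apply (ex_derive_continuous (fun t => cos (t * 0) * (1 - t / T)));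
      now auto_derive.
- exists ((1 - cos (T * th)) / (th ^ 2 * T)).
  assert (0 < th ^ 2 * T) by (apply Rmult_lt_0_compat; [now apply pow2_gt_0|lra]).
  repeat split; [| |lra].
  + replace ((1 - cos (T * th)) / (th ^ 2 * T))
      with (minus (sin (T * th) / th * (1 - T / T) - cos (T * th) / (th ^ 2 * T))
                  (sin (0 * th) / th * (1 - 0 / T) - cos (0 * th) / (th ^ 2 * T)))
      by (rewrite Rmult_0_l, sin_0, cos_0; unfold minus, plus, opp; simpl; field; lra).
    (* The antiderivative comes from integration by parts; its sine term vanishes at [T] with the
       weight and at 0 with the sine. *)
    apply (is_RInt_derive (fun t => sin (t * th) / th * (1 - t / T) - cos (t * th) / (th ^ 2 * T))).
    * intros t _; auto_derive; [trivial|field; lra].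
    * intros t _; apply (ex_derive_continuous (fun t => cos (t * th) * (1 - t / T)));
        now auto_derive.
  + apply Rdiv_le_0_compat; [generalize (COS_bound (T * th)); lra|lra].
Qed.

(** * Isolating one coefficient of a nonnegative series *)

Section Positivity.

Variables (b mu : nat -> R) (m : nat) (T : R).
Hypotheses (b_ge0 : forall k, 0 <= b k) (T_gt0 : 0 < T).

(** Applied with [b k = a_n n^(-c)] and [mu k = ln n] for [n = k + 1], these are the partial sums of
    [Re (f(c + i t) (m + 1)^(i t))]. *)
Let psum (K : nat) (t : R) : R := sum_n (fun k => b k * cos (t * (mu m - mu k))) K.

Lemma continuous_partial_sum (K : nat) (t : R) : continuous (psum K) t.
Proof.
assert (H : forall k, continuous (fun t => b k * cos (t * (mu m - mu k))) t).
{ intro k; apply (ex_derive_continuous (fun t => b k * cos (t * (mu m - mu k))));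
    now auto_derive. }
induction K as [|K IH]; unfold psum.
- apply continuous_ext with (2 := H O); intro u; now rewrite sum_O.
- apply continuous_ext with
    (fun t => plus (psum K t) (b (S K) * cos (t * (mu m - mu (S K)))));
    [intro u; unfold psum; now rewrite sum_Sn|].
  apply (continuous_plus (psum K)); [exact IH|apply H].
Qed.

(** All terms have nonnegative integrals, and the term of index [m] has frequency 0. *)
Lemma is_RInt_fejer_partial_sum (K : nat) :
  exists I, is_RInt (fun t => psum K t * (1 - t / T)) 0 T I /\
    0 <= I /\ ((m <= K)%nat -> b m * (T / 2) <= I).
Proof.
assert (H : forall k, exists I,
  is_RInt (fun t => b k * cos (t * (mu m - mu k)) * (1 - t / T)) 0 T I /\
  0 <= I /\ (k = m -> b m * (T / 2) <= I)).
{ intro k; destruct (is_RInt_fejer_cos (mu m - mu k) T T_gt0) as (I & HI & HI0 & HIm).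
  exists (b k * I); split; [|split].
  - eapply is_RInt_ext; [|exact (is_RInt_scal _ _ _ (b k) _ HI)].
    intros t _; unfold scal; simpl; unfold mult; simpl; ring.
  - now apply Rmult_le_pos.
  - intros ->; rewrite HIm by ring; lra. }
induction K as [|K (I & HI & HI0 & HIm)].
- destruct (H O) as (I & HI & HI0 & HIm); exists I; split; [|split; [exact HI0|]].
  + eapply is_RInt_ext; [|exact HI]; intros t _; unfold psum; now rewrite sum_O.
  + intro Hm; apply HIm; lia.
- destruct (H (S K)) as (J & HJ & HJ0 & HJm).
  exists (I + J); split; [|split; [lra|]].
  + eapply is_RInt_ext; [|exact (is_RInt_plus _ _ _ _ _ _ HI HJ)].
    intros t _; unfold psum; rewrite sum_Sn; unfold plus; simpl; ring.
  + intro Hm; destruct (Nat.eq_dec m (S K)) as [->|Hne].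
    * specialize (HJm eq_refl); lra.
    * specialize (HIm ltac:(lia)); lra.
Qed.

Lemma sum_n_tail_le (u : nat -> R) (K N : nat) :
  (forall k, Rabs (u k) <= b k) -> (K <= N)%nat ->
  Rabs (sum_n u N - sum_n u K) <= sum_n b N - sum_n b K.
Proof.
intros Hu; induction 1 as [|N HN IH].
- rewrite !Rminus_diag, Rabs_R0; lra.
- rewrite !sum_Sn; unfold plus; simpl.
  replace (sum_n u N + u (S N) - sum_n u K)
    with (sum_n u N - sum_n u K + u (S N)) by ring.
  eapply Rle_trans; [apply Rabs_triang|]; specialize (Hu (S N)); lra.
Qed.

Lemma term_bound (t : R) (k : nat) : Rabs (b k * cos (t * (mu m - mu k))) <= b k.
Proof.
rewrite Rabs_mult, (Rabs_pos_eq (b k)) by apply b_ge0.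
rewrite <- (Rmult_1_r (b k)) at 2; apply Rmult_le_compat_l; [apply b_ge0|].
apply Rabs_le, COS_bound.
Qed.

Lemma sum_n_le_series (B : R) (K : nat) : is_series b B -> sum_n b K <= B.
Proof.
intro HB; apply (is_lim_seq_incr_compare (sum_n b) B HB).
intro n; rewrite sum_Sn; unfold plus; simpl; generalize (b_ge0 (S n)); lra.
Qed.

(** The tail of the cosine series is dominated by the tail of [b], so the error does not depend on
    [t]. This takes the place of an interchange of sum and integral. *)
Lemma partial_sum_le_limit (t h B : R) (K : nat) :
  is_series b B -> is_series (fun k => b k * cos (t * (mu m - mu k))) h ->
  psum K t <= h + (B - sum_n b K).
Proof.
intros HB Hh.
assert (Hle : Rbar_le (psum K t - (B - sum_n b K)) h).
{ refine (is_lim_seq_le_loc (fun N => psum K t - (sum_n b N - sum_n b K))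
    (sum_n (fun k => b k * cos (t * (mu m - mu k)))) (Finite _) (Finite h) _ _ Hh).
  - exists K; intros N HN.
    generalize (sum_n_tail_le _ K N (term_bound t) HN); intro H.
    apply Rabs_le_between in H; fold (psum K t) in H; lra.
  - apply is_lim_seq_minus'; [apply is_lim_seq_const|].
    apply is_lim_seq_minus'; [exact HB|apply is_lim_seq_const]. }
simpl in Hle; lra.
Qed.

(* Partial sums rather than [h] are used on [0, t1], where [h] need not be known to
   be integrable. *)
Lemma coefficient_le_integral (B t1 : R) (h : R -> R) :
  is_series b B -> 0 < t1 < T ->
  (forall t, is_series (fun k => b k * cos (t * (mu m - mu k))) (h t)) ->
  ex_RInt (fun t => h t * (1 - t / T)) t1 T ->
  b m * (T / 2) <= t1 * B + RInt (fun t => h t * (1 - t / T)) t1 T.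
Proof.
intros HB Ht1 Hh Hint.
assert (HTi : 0 < / T) by (apply Rinv_0_lt_compat; lra).
assert (HTT : T * / T = 1) by (apply Rinv_r; lra).
assert (Hcw : forall K t, continuous (fun t => psum K t * (1 - t / T)) t).
{ intros K t; apply (continuous_mult (psum K) (fun t => 1 - t / T));
    [apply continuous_partial_sum|].
  apply (ex_derive_continuous (fun t => 1 - t / T)); now auto_derive. }
assert (Hex : forall K u v, ex_RInt (fun t => psum K t * (1 - t / T)) u v)
  by (intros; apply @ex_RInt_continuous; intros; apply Hcw).
(* Replacing the partial sum by [h] on [[t1, T]] costs at most [T * (B - sum_n b K)], which
   disappears as [K] grows. *)
assert (key : forall K, (m <= K)%nat ->
  b m * (T / 2) - T * (B - sum_n b K)
    <= t1 * B + RInt (fun t => h t * (1 - t / T)) t1 T).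
{ intros K HK.
  destruct (is_RInt_fejer_partial_sum K) as (I & HI & _ & HIm); specialize (HIm HK).
  rewrite <- (is_RInt_unique _ _ _ _ HI) in HIm.
  rewrite <- (RInt_Chasles _ 0 t1 T (Hex K _ _) (Hex K _ _)) in HIm.
  unfold plus in HIm; simpl in HIm.
  assert (HBK := sum_n_le_series B K HB).
  (* On [[0, t1]] the partial sums are at most [B] in absolute value and the weight lies between 0
     and 1. *)
  assert (H1 : RInt (fun t => psum K t * (1 - t / T)) 0 t1 <= (t1 - 0) * B).
  { eapply Rle_trans; [apply Rle_abs|].
    apply abs_RInt_le_const; [lra|apply Hex|intros t Ht].
    assert (Hs : Rabs (psum K t) <= B).
    { generalize (sum_n_tail_le _ O K (term_bound t) (Nat.le_0_l K)).
      generalize (term_bound t O); fold (psum K t); rewrite !sum_O; intros h0 h1.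
      replace (psum K t) with (b O * cos (t * (mu m - mu O))
        + (psum K t - b O * cos (t * (mu m - mu O)))) by ring.
      eapply Rle_trans; [apply Rabs_triang|lra]. }
    rewrite Rabs_mult, (Rabs_pos_eq (1 - t / T)) by (unfold Rdiv; nra).
    rewrite <- (Rmult_1_r B); apply Rmult_le_compat; try exact Hs;
      [apply Rabs_pos|unfold Rdiv; nra|unfold Rdiv; nra]. }
  assert (H2 : RInt (fun t => psum K t * (1 - t / T)) t1 T
     <= RInt (fun t => h t * (1 - t / T) + (B - sum_n b K)) t1 T).
  { apply RInt_le; [lra|apply Hex| |].
    - apply @ex_RInt_plus; [exact Hint|apply ex_RInt_const].
    - intros t Ht; generalize (partial_sum_le_limit t (h t) B K HB (Hh t)); intro H.
      assert (0 <= 1 - t / T <= 1) by (unfold Rdiv; nra).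
      nra. }
  rewrite (RInt_plus (V := R_CompleteNormedModule)) in H2;
    [|exact Hint|apply ex_RInt_const].
  rewrite (RInt_const (V := R_CompleteNormedModule)) in H2.
  unfold plus, scal in H2; simpl in H2; unfold mult in H2; simpl in H2.
  nra. }
assert (Hlim : Rbar_le (b m * (T / 2) - T * (B - B))
   (t1 * B + RInt (fun t => h t * (1 - t / T)) t1 T)).
{ refine (is_lim_seq_le_loc (fun K => b m * (T / 2) - T * (B - sum_n b K))
    (fun _ => t1 * B + RInt (fun t => h t * (1 - t / T)) t1 T)
    (Finite _) (Finite _) _ _ _).
  - exists m; exact key.
  - apply is_lim_seq_minus'; [apply is_lim_seq_const|].
    apply (is_lim_seq_scal_l _ T (Finite (B - B))).
    apply is_lim_seq_minus'; [apply is_lim_seq_const|exact HB].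
  - apply is_lim_seq_const. }
simpl in Hlim; lra.
Qed.

End Positivity.

(** * Dirichlet series *)

Lemma Cseries_to_components (u : nat -> C) (l : C) : Cseries_to u l ->
  is_series (fun k => Re (u k)) (Re l) /\ is_series (fun k => Im (u k)) (Im l).
Proof.
intro H; unfold Cseries_to, is_series in H.
assert (Hsum : forall N, sum_n u N = (sum_n (fun k => Re (u k)) N, sum_n (fun k => Im (u k)) N)).
{ induction N as [|N IH].
  - rewrite !sum_O; apply surjective_pairing.
  - rewrite !sum_Sn, IH; reflexivity. }
split; apply filterlim_locally; intro eps;
  generalize (proj1 (filterlim_locally _ _) H eps); apply filter_imp;
  intros N [H1 H2]; rewrite Hsum in H1, H2; [exact H1|exact H2].
Qed.

Lemma dirichlet_term_components (a : nat -> R) (c t : R) (k : nat) :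
  dirichlet_term a (c, t) k =
    (a (S k) * exp (- (c * ln (INR (S k)))) * cos (t * ln (INR (S k))),
     - (a (S k) * exp (- (c * ln (INR (S k)))) * sin (t * ln (INR (S k))))).
Proof.
unfold dirichlet_term, Cexp, Cmult, RtoC, Copp, Re, Im; cbn [fst snd].
set (mu := ln (INR (S k))).
replace (- c * mu - - t * 0) with (- (c * mu)) by ring.
replace (- c * 0 + - t * mu) with (- (t * mu)) by ring.
rewrite cos_neg, sin_neg; f_equal; ring.
Qed.

(** On [Re s = c] the exponential is the phase [(cos (t * lam), sin (t * lam))], and the cosine
    subtraction formula merges the real and imaginary series. *)
Lemma is_series_twisted (a : nat -> R) (c t : R) (l : C) (m : nat) :
  Cseries_to (dirichlet_term a (c, t)) l ->
  is_series (fun k => a (S k) * exp (- (c * ln (INR (S k)))) *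
      cos (t * (ln (INR (S m)) - ln (INR (S k)))))
    (Re (l * Cexp (((c, t) - RtoC c) * RtoC (ln (INR (S m)))))%C).
Proof.
intro H; destruct (Cseries_to_components _ _ H) as [H1 H2].
set (lam := ln (INR (S m))).
assert (E : Cexp (((c, t) - RtoC c) * RtoC lam) = (cos (t * lam), sin (t * lam))).
{ unfold Cexp, Cminus, Cplus, Cmult, RtoC, Copp, Re, Im; cbn [fst snd].
  replace ((c + - c) * lam - (t + - 0) * 0) with 0 by ring.
  replace ((c + - c) * 0 + (t + - 0) * lam) with (t * lam) by ring.
  rewrite exp_0; f_equal; ring. }
rewrite E.
replace (Re (l * (cos (t * lam), sin (t * lam)))%C)
  with (cos (t * lam) * Re l + - (sin (t * lam) * Im l)) by (unfold Re, Im; simpl; ring).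
generalize (is_series_minus _ _ _ _ (is_series_scal_l (cos (t * lam)) _ _ H1)
  (is_series_scal_l (sin (t * lam)) _ _ H2)).
apply is_series_ext; intro k; rewrite dirichlet_term_components.
rewrite Rmult_minus_distr_l, cos_minus; fold lam.
set (mu := ln (INR (S k))); set (w := a (S k) * exp (- (c * mu))).
change (cos (t * lam) * (w * cos (t * mu)) + - (sin (t * lam) * - (w * sin (t * mu)))
  = w * (cos (t * lam) * cos (t * mu) + sin (t * lam) * sin (t * mu))); ring.
Qed.

(** Combines [coefficient_le_integral] and [contour_shift] for [lam = ln (m + 1)]. The dominating
    series sums to the value of [f] at the real point [c], where the bound near 1 will enter. *)
Lemma coefficient_contour_bound (a : nat -> R) (f : C -> C) (m : nat)
    (sg c t1 T M : R) :
  (forall n : nat, (1 <= n)%nat -> 0 <= a n) ->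
  (forall s : C, 1 < Re s -> Cseries_to (dirichlet_term a s) (f s)) ->
  1 < c -> sg < c -> c - sg <= 2 -> 0 < t1 -> t1 < T -> 1 <= T -> 0 <= M ->
  (forall u t, sg <= u <= c -> t1 <= t <= T ->
     @ex_derive C_AbsRing C_NormedModule f (u, t)) ->
  (forall u t, sg <= u <= c -> t1 <= t <= T -> Cmod (f (u, t)) <= M * t) ->
  a (S m) * exp (- (c * ln (INR (S m)))) * (T / 2) <=
    t1 * Cmod (f (c, 0))
    + (3 * M * exp ((sg - c) * ln (INR (S m))) * T ^ 2 + 6 * M * t1 + 4 * M).
Proof.
intros Ha Hf Hc Hsg Hc2 Ht1 HT HT1 HM Hder Hbd.
assert (Hlam : 0 <= ln (INR (S m))).
{ rewrite <- ln_1; apply ln_le; [lra|apply (le_INR 1); lia]. }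
destruct (contour_shift f sg c t1 T (ln (INR (S m))) M) as [Hex Hle]; trivial.
assert (Hb : forall k, 0 <= a (S k) * exp (- (c * ln (INR (S k))))).
{ intro k; apply Rmult_le_pos; [apply Ha; lia|apply Rlt_le, exp_pos]. }
assert (HB : is_series (fun k => a (S k) * exp (- (c * ln (INR (S k))))) (Re (f (c, 0)))).
{ destruct (Cseries_to_components _ _ (Hf (c, 0) Hc)) as [H _].
  assert (E : forall k, Re (dirichlet_term a (c, 0) k)
     = a (S k) * exp (- (c * ln (INR (S k))))).
  { intro k; rewrite dirichlet_term_components.
    unfold Re; cbn [fst]; rewrite Rmult_0_l, cos_0; ring. }
  exact (is_series_ext _ _ _ E H). }
eapply Rle_trans.
- apply (coefficient_le_integral _ (fun k => ln (INR (S k))) m T Hb ltac:(lra)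
    (Re (f (c, 0))) t1 (fun t => Re (twist f c (ln (INR (S m))) (c, t))) HB ltac:(lra)).
  + intro t; now apply is_series_twisted, Hf.
  + exact Hex.
- apply Rplus_le_compat; [|exact Hle].
  apply Rmult_le_compat_l; [lra|].
  eapply Rle_trans; [apply Rle_abs|apply re_le_Cmod].
Qed.

(** * The function [F_infty]: finiteness, growth and near minimizers *)

Section FInfinity.

Variables (F : R -> R) (cF : R).
Hypotheses (cF_gt0 : 0 < cF) (F_ge : forall u, 0 < u -> cF * u <= F u).

(** Since [X ^ eps >= eps * ln X] and [F (1 / eps) >= cF / eps], the factor [eps] cancels. *)
Lemma F_infty_value_ge (X eps : R) : 0 < eps -> 0 < ln X ->
  cF * ln X <= Rpower X eps * F (1 / eps).
Proof.
intros He HX.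
assert (Hi : 0 < 1 / eps) by (apply Rdiv_lt_0_compat; lra).
specialize (F_ge _ Hi).
replace (cF * ln X) with (eps * ln X * (cF * (1 / eps))) by (field; lra).
apply Rmult_le_compat; try assumption.
- apply Rlt_le, Rmult_lt_0_compat; lra.
- apply Rlt_le, Rmult_lt_0_compat; lra.
- unfold Rpower; generalize (exp_ineq1_le (eps * ln X)); lra.
Qed.

Lemma F_infty_glb (X : R) : 0 < ln X ->
  (forall eps, 0 < eps -> F_infty F X <= Rpower X eps * F (1 / eps)) /\
  (forall v, (forall eps, 0 < eps -> v <= Rpower X eps * F (1 / eps)) ->
     v <= F_infty F X).
Proof.
intro HX; unfold F_infty.
set (E := fun v => exists eps, 0 < eps /\ v = Rpower X eps * F (1 / eps)).
destruct (Glb_Rbar_correct E) as [Hlb Hglb].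
(* The value at [eps = 1] and the lower bound [cF * ln X] exclude infinite values, so [real] returns
   the true infimum. *)
assert (H1 : Rbar_le (Glb_Rbar E) (Rpower X 1 * F (1 / 1)))
  by (apply Hlb; exists 1; split; [lra|reflexivity]).
assert (H2 : Rbar_le (cF * ln X) (Glb_Rbar E)).
{ apply Hglb; intros v (eps & He & ->); now apply F_infty_value_ge. }
destruct (Glb_Rbar E) as [g| |]; [|contradiction|contradiction].
split.
- intros eps He; apply (Hlb (Rpower X eps * F (1 / eps))); now exists eps.
- intros v Hv; apply (Hglb (Finite v)); intros w (eps & He & ->); now apply Hv.
Qed.

Lemma F_infty_ge (X : R) : 0 < ln X -> cF * ln X <= F_infty F X.
Proof.
intro HX; apply F_infty_glb; [exact HX|intros; now apply F_infty_value_ge].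
Qed.

(* Large [eps] cannot come close to the infimum: there [X ^ eps / eps] exceeds
   [X ^ (3 eta / 4)], whereas [eps := eta / 2] gives a value of order [X ^ (eta / 2)]. *)
Lemma F_infty_near_minimizer (X eta : R) : 0 < eta -> 1 <= ln X ->
  33 * F (2 / eta) / (cF * eta) <= ln X ->
  exists eps, 0 < eps < eta /\ Rpower X eps * F (1 / eps) <= 2 * F_infty F X.
Proof.
intros Heta HL1 HL.
assert (HL0 : 0 < ln X) by lra.
assert (Hpos := F_infty_ge X HL0).
destruct (F_infty_glb X HL0) as [Hlb Hglb].
assert (Hphi : 0 < F_infty F X).
{ assert (0 < cF * ln X) by (apply Rmult_lt_0_compat; lra); lra. }
(* If no value were below twice the infimum, [2 * F_infty F X] would be a lower bound exceeding the
   greatest one. *)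
destruct (classic
  (exists eps, 0 < eps /\ Rpower X eps * F (1 / eps) < 2 * F_infty F X))
  as [(eps & He & Hlt)|Hno].
2: { exfalso.
  assert (2 * F_infty F X <= F_infty F X); [|lra].
  apply Hglb; intros eps He; apply Rnot_lt_le; intro Hlt; apply Hno; now exists eps. }
exists eps; split; [split; [exact He|]|lra].
apply Rnot_le_lt; intro Hge.
assert (Hup := Hlb (eta / 2) ltac:(lra)).
replace (1 / (eta / 2)) with (2 / eta) in Hup by (field; lra).
set (L := ln X) in *; set (F2 := F (2 / eta)) in *.
assert (Hce : 0 < cF * eta) by (apply Rmult_lt_0_compat; lra).
apply Rle_div_l in HL; [|lra].
assert (HF2 : 0 < F2).
{ assert (Hi : 0 < 2 / eta) by (apply Rdiv_lt_0_compat; lra).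
  generalize (F_ge _ Hi); fold F2.
  assert (0 < cF * (2 / eta)) by (apply Rmult_lt_0_compat; lra); lra. }
assert (Hi : 0 < 1 / eps) by (apply Rdiv_lt_0_compat; lra).
assert (HFe := F_ge _ Hi).
set (q := exp (eta / 2 * L)) in *.
assert (Hq : 0 < q) by apply exp_pos.
unfold Rpower in Hlt, Hup; fold L in Hlt, Hup; fold q in Hup.
(* Three quarters of the exponent give [q * (eta * L / 4)] through [eps >= eta]. The last quarter
   gives [eps * L / 4], whose [eps] cancels against [F (1 / eps) >= cF / eps]. *)
assert (Hexp : q * (eta * L / 4) * (eps * L / 4) <= exp (eps * L)).
{ replace (exp (eps * L)) with (exp (eps * L * (3 / 4)) * exp (eps * L / 4))
    by (rewrite <- exp_plus; f_equal; field).
  assert (0 < eta * L) by (apply Rmult_lt_0_compat; lra).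
  assert (eta * L <= eps * L) by (apply Rmult_le_compat_r; lra).
  apply Rmult_le_compat.
  - apply Rmult_le_pos; lra.
  - lra.
  - apply Rle_trans with (exp (eta * L * (3 / 4))); [|apply exp_le_compat; lra].
    replace (eta * L * (3 / 4)) with (eta / 2 * L + eta * L / 4) by field.
    rewrite exp_plus; fold q; apply Rmult_le_compat_l; [lra|].
    generalize (exp_ineq1_le (eta * L / 4)); lra.
  - generalize (exp_ineq1_le (eps * L / 4)); lra. }
assert (Hbig : q * (eta * L / 4) * (L / 4) * cF <= exp (eps * L) * F (1 / eps)).
{ apply Rle_trans with (q * (eta * L / 4) * (eps * L / 4) * (cF * (1 / eps))).
  - apply Req_le; field; lra.
  - apply Rmult_le_compat; [| |exact Hexp|exact HFe].
    + assert (0 < eta * L) by (apply Rmult_lt_0_compat; lra).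
      assert (0 < eps * L) by (apply Rmult_lt_0_compat; lra).
      apply Rmult_le_pos; [apply Rmult_le_pos|]; lra.
    + apply Rlt_le, Rmult_lt_0_compat; lra. }
(* The contradiction needs [32 * F2 < cF * eta * L ^ 2]; the constant 33 makes this strict. *)
assert (Hcmp : q * (2 * F2) < q * ((cF * eta) * L * L / 16)).
{ apply Rmult_lt_compat_l; [exact Hq|].
  assert (33 * F2 <= L * (cF * eta) * L) by nra.
  lra. }
lra.
Qed.

End FInfinity.

(** * Choice of the parameters and conclusion *)

Lemma sup_upto_le (a : nat -> R) (x v : R) : 0 <= v ->
  (forall n, (1 <= n)%nat -> INR n <= x -> a n <= v) -> sup_upto a x <= v.
Proof.
intros Hv H; unfold sup_upto.
set (E := fun w => exists n : nat, (1 <= n)%nat /\ INR n <= x /\ w = a n).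
assert (Hl : Rbar_le (Lub_Rbar E) v).
{ apply (Lub_Rbar_correct E); intros w (n & Hn & Hx & ->); now apply H. }
(* An empty set has supremum minus infinity, which [real] sends to 0; this is the case closed by
   [0 <= v]. *)
destruct (Lub_Rbar E); [exact Hl|contradiction|exact Hv].
Qed.

Lemma pow2_le_inv (u v : R) : 0 <= v -> u ^ 2 <= v ^ 2 -> u <= v.
Proof. intros Hv H; apply Rnot_lt_le; intro Hlt; nra. Qed.

Theorem theorem2 (a : nat -> R) (f : C -> C) (sigma F : R -> R) (delta : R)
  (a_ge0 : forall n : nat, (1 <= n)%nat -> 0 <= a n)
  (f_abs_cv : forall s : C, 1 < Re s ->
     ex_series (fun k => Cmod (dirichlet_term a s k)))
  (f_series : forall s : C, 1 < Re s -> Cseries_to (dirichlet_term a s) (f s))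
  (sigma_pos : forall x : R, 0 < x -> 0 < sigma x)
  (sigma_cont : forall x : R, 0 < x -> continuous sigma x)
  (sigma_nondecr : forall x y : R, 0 < x -> x <= y -> sigma x <= sigma y)
  (delta_gt0 : 0 < delta)
  (sigma_gt_delta : forall x : R, 0 < x -> delta < sigma x)
  (sigma_le : exists x0 : R, forall x : R, x0 <= x ->
     sigma x <= 1 - 2 * ln (ln x) / ln x)
  (F_pos : forall x : R, 0 < x -> 0 < F x)
  (F_incr : forall x y : R, 0 < x -> x < y -> F x < F y)
  (F_growth : exists c : R, 0 < c /\ forall x : R, 0 < x -> c * x <= F x)
  (f_analytic : analytic_on f (region sigma))
  (f_near_1 : exists M r : R, 0 < r /\
     forall s : C, 0 < Cmod (s - RtoC 1)%C < r ->
       Cmod (f s) <= M * F (1 / Cmod (s - RtoC 1)%C))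
  (f_growth : exists M t0 : R, forall s : C,
     t0 <= Rabs (Im s) -> sigma (Rabs (Im s)) <= Re s ->
       Cmod (f s) <= M * Rabs (Im s)) :
  exists M x0 : R, forall x : R, x0 <= x ->
    sup_upto a x <=
      M * (Rpower x ((sigma x + 1) / 2) * sqrt (ln x) * sqrt (F_infty F (2 * x))).
Proof.
destruct sigma_le as [x0 Hsig].
destruct F_growth as (cF & HcF & HF).
destruct f_near_1 as (M1 & r & Hr & Hnear).
destruct f_growth as (M2 & t0 & Hgr).
(* From height [t1] on, the growth bound holds and the point 1 is avoided. Taking [eps < eta] keeps
   [c = 1 + eps] in the given neighbourhood of 1 and [c - sigma x] below 2. *)
set (t1 := Rmax 1 t0).
set (eta := Rmin r 1).
set (N := Rabs M1); set (M := Rabs M2).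
assert (Ht1 : 1 <= t1) by apply Rmax_l.
assert (Ht01 : t0 <= t1) by apply Rmax_r.
assert (Heta : 0 < eta) by (apply Rmin_glb_lt; lra).
assert (Hetar : eta <= r) by apply Rmin_l.
assert (Heta1 : eta <= 1) by apply Rmin_r.
assert (HN : 0 <= N) by apply Rabs_pos.
assert (HM : 0 <= M) by apply Rabs_pos.
(* The first summand comes from [t1 * f(c)]; the second absorbs the bounded contour terms through
   [F (1 / eps) >= cF]. *)
set (K1 := t1 * N + (6 * t1 + 4) * M / cF).
assert (HF1 : 0 < F 1) by (apply F_pos; lra).
(* Thresholds for [ln x]: [Y1] yields a near minimizer below [eta], [Y2] yields [T >= t1 + 1], and
   [Y3] yields [T <= x]. *)
set (Y1 := 33 * F (2 / eta) / (cF * eta)).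
set (Y2 := (t1 + 1) ^ 2 / cF).
set (Y3 := 2 * F 1 / delta).
assert (HY1 : 0 <= Y1).
{ apply Rlt_le, Rdiv_lt_0_compat; [|apply Rmult_lt_0_compat; lra].
  apply Rmult_lt_0_compat; [lra|apply F_pos, Rdiv_lt_0_compat; lra]. }
assert (HY2 : 0 <= Y2) by (apply Rdiv_le_0_compat; [apply pow2_ge_0|lra]).
assert (HY3 : 0 <= Y3) by (apply Rdiv_le_0_compat; lra).
exists (4 * K1 + 6 * M), (exp (1 + Rabs x0 + Y1 + Y2 + Y3)).
intros x Hx.
assert (Hx0 : 0 < x) by (eapply Rlt_le_trans; [apply exp_pos|exact Hx]).
set (y := ln x).
assert (Hxy : x = exp y) by (symmetry; now apply exp_ln).
assert (Hy : 1 + Rabs x0 + Y1 + Y2 + Y3 <= y).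
{ rewrite <- (ln_exp (1 + _ + _ + _ + _)); apply ln_le; [apply exp_pos|exact Hx]. }
assert (Hy1 : 1 <= y) by (generalize (Rabs_pos x0); lra).
assert (Hx0x : x0 <= x).
{ rewrite Hxy; generalize (exp_ineq1_le y) (Rle_abs x0) ; lra. }
assert (Hs1 : sigma x <= 1).
{ eapply Rle_trans; [now apply Hsig|]; fold y.
  assert (0 <= 2 * ln y / y); [|lra].
  apply Rdiv_le_0_compat; [|lra].
  assert (ln 1 <= ln y) by (apply ln_le; lra); rewrite ln_1 in *; lra. }
assert (Hsd : delta < sigma x) by now apply sigma_gt_delta.
set (sg := sigma x) in *.
assert (HyL : y <= ln (2 * x)) by (apply ln_le; lra).
set (Phi := F_infty F (2 * x)).
assert (HPhi : cF * ln (2 * x) <= Phi) by (apply F_infty_ge; trivial; lra).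
assert (HPhi1 : Phi <= 2 * exp y * F 1).
{ destruct (F_infty_glb F cF HcF HF (2 * x)) as [Hlb _]; [lra|].
  specialize (Hlb 1 Rlt_0_1); rewrite Rpower_1, Rdiv_1_r in Hlb by lra.
  rewrite <- Hxy; exact Hlb. }
destruct (F_infty_near_minimizer F cF HcF HF (2 * x) eta) as (eps & Heps & Hmin);
  [exact Heta|lra|fold Y1; generalize (Rabs_pos x0); lra|].
fold Phi in Hmin.
assert (HPhiY2 : (t1 + 1) ^ 2 <= Phi).
{ eapply Rle_trans; [|exact HPhi].
  apply Rle_trans with (cF * Y2); [apply Req_le; unfold Y2; field; lra|].
  apply Rmult_le_compat_l; [lra|generalize (Rabs_pos x0); lra]. }
assert (HPhi0 : 0 < Phi) by nra.
set (Fe := F (1 / eps)) in *.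
assert (HFe : cF <= Fe).
{ assert (Hi : 0 < 1 / eps) by (apply Rdiv_lt_0_compat; lra).
  eapply Rle_trans; [|apply (HF _ Hi)].
  rewrite <- (Rmult_1_r cF) at 1; apply Rmult_le_compat_l; [lra|].
  apply Rle_div_r; lra. }
(* This [T] makes the two terms [x * Phi / T] and [x ^ sg * T] equal. *)
set (T := exp ((1 - sg) / 2 * y) * sqrt Phi).
assert (HT2 : T ^ 2 = exp ((1 - sg) * y) * Phi).
{ unfold T; rewrite Rpow_mult_distr, pow2_sqrt by lra; f_equal.
  simpl; rewrite Rmult_1_r, <- exp_plus; f_equal; field. }
assert (HTpos : 0 < T) by (apply Rmult_lt_0_compat; [apply exp_pos|now apply sqrt_lt_R0]).
assert (HTt1 : t1 + 1 <= T).
{ apply pow2_le_inv; [lra|]; rewrite HT2.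
  apply Rle_trans with (1 * Phi); [lra|apply Rmult_le_compat_r; [lra|]].
  assert (0 <= (1 - sg) * y) by (apply Rmult_le_pos; lra).
  generalize (exp_ineq1_le ((1 - sg) * y)); lra. }
(* The value at [eps = 1] gives [Phi <= 2 * x * F 1], and [x ^ delta >= delta * ln x >= 2 * F 1];
   hence [T ^ 2 <= x ^ 2]. *)
assert (HTx : T <= x).
{ apply pow2_le_inv; [lra|]; rewrite HT2, Hxy.
  apply Rle_trans with (exp ((1 - delta) * y) * (2 * exp y * F 1)).
  - apply Rmult_le_compat; [apply Rlt_le, exp_pos|lra| |exact HPhi1].
    apply exp_le_compat, Rmult_le_compat_r; lra.
  - replace (exp y ^ 2) with (exp ((1 - delta) * y) * exp y * exp (delta * y))
      by (simpl; rewrite Rmult_1_r, <- !exp_plus; f_equal; ring).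
    replace (exp ((1 - delta) * y) * (2 * exp y * F 1))
      with (exp ((1 - delta) * y) * exp y * (2 * F 1)) by ring.
    apply Rmult_le_compat_l; [apply Rmult_le_pos; apply Rlt_le, exp_pos|].
    assert (delta * Y3 <= delta * y)
      by (apply Rmult_le_compat_l; [lra|generalize (Rabs_pos x0); lra]).
    replace (delta * Y3) with (2 * F 1) in * by (unfold Y3; field; lra).
    generalize (exp_ineq1_le (delta * y)); lra. }
assert (HK1 : 0 <= K1).
{ unfold K1; apply Rplus_le_le_0_compat; [apply Rmult_le_pos; lra|].
  apply Rdiv_le_0_compat; [apply Rmult_le_pos; lra|exact HcF]. }
(* [Bd] is the common size [x * Phi / T] of the two balanced terms. *)
set (Bd := exp ((sg + 1) / 2 * y) * sqrt Phi).
assert (HBd : 0 < Bd) by (apply Rmult_lt_0_compat; [apply exp_pos|now apply sqrt_lt_R0]).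
assert (HTB : T * Bd = exp y * Phi).
{ unfold T, Bd.
  replace (exp ((1 - sg) / 2 * y) * sqrt Phi * (exp ((sg + 1) / 2 * y) * sqrt Phi))
    with (exp ((1 - sg) / 2 * y) * exp ((sg + 1) / 2 * y) * (sqrt Phi * sqrt Phi)) by ring.
  rewrite sqrt_sqrt, <- exp_plus by lra; f_equal; f_equal; field. }
(* As [t <= T <= x], monotonicity of [sigma] places the whole rectangle to the right of the
   boundary. *)
assert (Hrect : forall u t, sg <= u -> t1 <= t <= T -> sigma (Rabs t) <= u).
{ intros u t Hu Ht; eapply Rle_trans; [|exact Hu].
  apply sigma_nondecr; rewrite Rabs_pos_eq; lra. }
assert (Hn : forall n, (1 <= n)%nat -> INR n <= x -> a n <= (4 * K1 + 6 * M) * Bd).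
{ intros [|m] Hm Hmx; [lia|].
  assert (Hlam : 0 <= ln (INR (S m)) <= y).
  { assert (1 <= INR (S m)) by (apply (le_INR 1); lia).
    split; [rewrite <- ln_1; apply ln_le; lra|apply ln_le; lra]. }
  generalize (coefficient_contour_bound a f m sg (1 + eps) t1 T M a_ge0 f_series
    ltac:(lra) ltac:(lra) ltac:(lra) ltac:(lra) ltac:(lra) ltac:(lra) HM).
  set (lam := ln (INR (S m))) in *.
  intro Hmain.
  assert (Hineq : a (S m) * exp (- ((1 + eps) * lam)) * (T / 2) <=
    t1 * Cmod (f (1 + eps, 0))
    + (3 * M * exp ((sg - (1 + eps)) * lam) * T ^ 2 + 6 * M * t1 + 4 * M)).
  { apply Hmain.
    - intros u t Hu Ht.
      apply (locally_singleton (T := C_UniformSpace) (u, t)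
        (fun w => @ex_derive C_AbsRing C_NormedModule f w)).
      (* Since [t >= t1 > 0], the boundary is [sigma] at [|t|] and the point differs from 1. *)
      apply f_analytic; split.
      + unfold left_boundary; cbn [Re Im fst snd].
        destruct (Req_EM_T t 0); [lra|apply Hrect; lra].
      + intro E; injection E; lra.
    - intros u t Hu Ht.
      eapply Rle_trans; [apply Hgr|]; cbn [Re Im fst snd].
      + rewrite Rabs_pos_eq; lra.
      + apply Hrect; lra.
      + rewrite (Rabs_pos_eq t) by lra.
        apply Rmult_le_compat_r; [lra|apply Rle_abs]. }
  clear Hmain.
  assert (Hfc : Cmod (f (1 + eps, 0)) <= N * Fe).
  { assert (Hd : Cmod (((1 + eps)%R, 0%R) - RtoC 1)%C = eps).
    { replace (((1 + eps)%R, 0%R) - RtoC 1)%C with (RtoC eps)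
        by (unfold Cminus, Cplus, Copp, RtoC; simpl; f_equal; ring).
      rewrite Cmod_R; apply Rabs_pos_eq; lra. }
    generalize (Hnear (1 + eps, 0)); rewrite Hd; intro H.
    eapply Rle_trans; [apply H; lra|].
    apply Rmult_le_compat_r; [change (0 <= Fe); lra|apply Rle_abs]. }
  set (e1 := exp ((1 + eps) * lam)).
  assert (He1 : 0 < e1) by apply exp_pos.
  assert (Hinv : exp (- ((1 + eps) * lam)) * e1 = 1)
    by (unfold e1; rewrite <- exp_plus, Rplus_opp_l; apply exp_0).
  assert (Hsg : exp ((sg - (1 + eps)) * lam) * e1 = exp (sg * lam))
    by (unfold e1; rewrite <- exp_plus; f_equal; ring).
  assert (Hrest : t1 * (N * Fe) + (6 * M * t1 + 4 * M) <= K1 * Fe).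
  { unfold K1.
    apply Rle_trans with (t1 * (N * Fe) + (6 * t1 + 4) * M / cF * cF);
      [apply Req_le; field; lra|].
    assert (0 <= (6 * t1 + 4) * M / cF)
      by (apply Rdiv_le_0_compat; [apply Rmult_le_pos; lra|exact HcF]).
    nra. }
  (* Multiplying by [2 * e1], with [e1 = n^(1 + eps)], clears [n^(-c)] and turns [n^(sg - c)] into
     [n^sg]. *)
  assert (HaT : a (S m) * T <= 2 * (e1 * (K1 * Fe)) + 6 * M * exp (sg * lam) * T ^ 2).
  { replace (a (S m) * T)
      with (2 * e1 * (a (S m) * exp (- ((1 + eps) * lam)) * (T / 2)))
      by (replace (2 * e1 * (a (S m) * exp (- ((1 + eps) * lam)) * (T / 2)))
            with (a (S m) * T * (exp (- ((1 + eps) * lam)) * e1)) by field;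
          rewrite Hinv; ring).
    rewrite <- Hsg.
    apply Rle_trans with (2 * e1 * (K1 * Fe
      + 3 * M * exp ((sg - (1 + eps)) * lam) * T ^ 2)).
    - apply Rmult_le_compat_l; [lra|].
      assert (t1 * Cmod (f (1 + eps, 0)) <= t1 * (N * Fe))
        by (apply Rmult_le_compat_l; lra).
      lra.
    - apply Req_le; ring. }
  (* From [n <= x] one has [n^(1 + eps) <= x * (2 * x)^eps]; the factor 2 on the right is the loss
     in the choice of [eps]. *)
  assert (He1F : e1 * Fe <= exp y * (2 * Phi)).
  { apply Rle_trans with (exp y * (Rpower (2 * x) eps * Fe));
      [|apply Rmult_le_compat_l; [apply Rlt_le, exp_pos|exact Hmin]].
    rewrite <- Rmult_assoc; apply Rmult_le_compat_r; [lra|].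
    unfold e1, Rpower; rewrite <- exp_plus; apply exp_le_compat.
    assert (eps * lam <= eps * ln (2 * x)) by (apply Rmult_le_compat_l; lra).
    lra. }
  (* Here [n^sg <= x^sg] and [T ^ 2 = x^(1 - sg) * Phi], so this term is again at most
     [x * Phi = T * Bd]. *)
  assert (HsgT : exp (sg * lam) * T ^ 2 <= exp y * Phi).
  { apply Rle_trans with (exp (sg * y) * T ^ 2).
    - apply Rmult_le_compat_r; [apply pow2_ge_0|].
      apply exp_le_compat, Rmult_le_compat_l; lra.
    - rewrite HT2, <- Rmult_assoc, <- exp_plus; apply Req_le; f_equal; f_equal; ring. }
  apply Rmult_le_reg_r with T; [exact HTpos|].
  replace ((4 * K1 + 6 * M) * Bd * T) with ((4 * K1 + 6 * M) * (T * Bd)) by ring.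
  rewrite HTB.
  assert (K1 * (e1 * Fe) <= K1 * (exp y * (2 * Phi))) by (apply Rmult_le_compat_l; lra).
  assert (M * (exp (sg * lam) * T ^ 2) <= M * (exp y * Phi))
    by (apply Rmult_le_compat_l; lra).
  lra. }
apply Rle_trans with ((4 * K1 + 6 * M) * Bd).
- apply sup_upto_le; [apply Rmult_le_pos; lra|exact Hn].
- apply Rmult_le_compat_l; [lra|].
  change (Rpower x ((sg + 1) / 2)) with (exp ((sg + 1) / 2 * y)).
  unfold Bd; apply Rmult_le_compat_r; [apply sqrt_pos|].
  (* The factor [sqrt (ln x)] is at least 1 because [y >= 1]. *)
  rewrite <- (Rmult_1_r (exp _)) at 1; apply Rmult_le_compat_l; [apply Rlt_le, exp_pos|].
  rewrite <- sqrt_1; apply sqrt_le_1; lra.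
Qed.
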